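(* Let $W$ be one of the Coxeter groups $A_{n-1}$, i.e. the symmetric group $S_n$ with generating set $S=\{(i,i+1)\mid i=1,\dots,n-1\}$, let $p$ be a prime, and let $K\in E$, $L\in F$. Then $d_{KL}=1$ if and only if $c_K$ and $c_L$ have conjugate $p$-regular parts (conjugate in $W$).
   Context: For $J\subseteq S$, $W_J=\langle J\rangle$ and $c_J$ is a Coxeter element of $W_J$ (the product of the elements of $J$ in some order). $E$ is a set of representatives of the $W$-conjugacy classes of subsets of $S$. For $J,K\subseteq S$, $\beta_{JK}$ is the number of fixed points of $W_K$ on the coset space $W/W_J$; $M^c(W)=(\beta_{JK})_{J,K\in E}$ is the parabolic table of marks. For a prime $p$, $F\subseteq E$ is the set of $J\in E$ whose row of $M^c(W)$ is non-zero modulo $p$ (equivalently, $p\nmid [N_W(W_J):W_J]$). For $K\in E$, $L\in F$, $d_{KL}=1$ if columns $K$ and $L$ of $M^c(W)$ are equal modulo $p$, and $d_{KL}=0$ otherwise; $D=(d_{KL})$ is the decomposition matrix of the descent algebra $\Sigma_W$ modulo $p$. The $p$-regular part of $w\in W$ is the element $w'$ in the unique factorization $w=w'w''=w''w'$ with $w'$ of order prime to $p$ and $w''$ of $p$-power order. *)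

(* Defs.v *)
From mathcomp Require Import all_boot all_fingroup all_solvable.

Set Implicit Arguments.
Unset Strict Implicit.
Unset Printing Implicit Defensive.

Local Open Scope group_scope.

(* The group W is the whole of gT, and S is its set of Coxeter generators. *)
Section ParabolicTableOfMarks.

Variable gT : finGroupType.
Implicit Types (S J K L : {set gT}) (E : {set {set gT}}).

Definition conj_representatives S E : bool :=
  is_transversal E
    (equivalence_partition (fun J K => K \in J :^: [set: gT]) (powerset S))
    (powerset S).

(* Any order of the factors is allowed, so J may have several Coxeter elements. *)
Definition coxeter_element J (c : gT) : Prop :=
  exists2 s : seq gT, perm_eq s (enum J) & c = \prod_(x <- s) x.

(* The coset space is that of the cosets W_J w, on which W acts by right
   translation; inversion identifies it with that of the cosets w W_J under
   left translation. *)
Definition mark J K : nat :=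
  #|'Fix_(rcosets <<J>> [set: gT] | 'Rs)(<<K>>)|.

Definition nonzero_rows E (p : nat) : {set {set gT}} :=
  [set J in E | [exists K in E, (mark J K != 0 %[mod p])%N]].

Definition decomposition_entry E (p : nat) K L : nat :=
  if [forall J in E, (mark J K == mark J L %[mod p])%N] then 1%N else 0%N.

End ParabolicTableOfMarks.

Definition simple_transpositions (n : nat) : {set 'S_n} :=
  [set s | [exists i : 'I_n, exists j : 'I_n,
              (j == i.+1 :> nat) && (s == tperm i j)]].

(* Main.v *)
(* The mark of J at K depends only on the orbits of W_K, which are those of any
   Coxeter element c_K, so it is the number of cosets fixed by c_K; modulo p this
   is also the number of cosets fixed by the p-regular part c_K'. Hence columns
   K and L agree modulo p as soon as c_K' and c_L' are conjugate.
   Conversely, start from W_K and repeatedly adjoin p-subgroups of the normaliser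
   and pass to the Young subgroup of the resulting orbits. Neither the column
   modulo p nor the p'-parts of the orbit sizes change, and when the process stops
   the index in the normaliser is prime to p. If column L is the same and L lies
   in F, the final group and W_L are each contained in a conjugate of the other.
   Thus W_K and W_L have the same p'-parts of orbit sizes up to a relabelling of
   the points; these are the orbit sizes of c_K' and c_L', which determine the
   conjugacy class. *)
Require Import Defs.
From mathcomp Require Import all_boot all_fingroup all_solvable.

Set Implicit Arguments.
Unset Strict Implicit.
Unset Printing Implicit Defensive.

Import GroupScope.
Local Open Scope group_scope.

(** * Counting cosets fixed by a subgroup *)

Section FixedCosets.

Variable gT : finGroupType.
Implicit Types (G H M P Y : {group gT}).

(** The hypothesis makes [X] a disjoint union of right cosets of [M], all of size [#|M|]. *)
Lemma card_rcosets_mul M (X : {set gT}) :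
  M * X \subset X -> #|X| = (#|rcosets M X| * #|M|)%N.
Proof.
move=> sMX; rewrite -sum1_card.
rewrite (partition_big (rcoset M) (mem (rcosets M X))); last first.
  by move=> x Xx /=; apply/rcosetsP; exists x; rewrite ?rcosetE.
rewrite -sum_nat_const; apply: eq_bigr => _ /rcosetsP[x Xx ->].
rewrite -(card_rcoset M x) -sum1_card; apply: eq_bigl => y.
rewrite rcosetE; apply/andP/idP => [[_ /eqP <-]|Mxy]; first exact: rcoset_refl.
split; last by apply/eqP/rcoset_eqP.
have /rcosetP[m Mm ->] := Mxy.
by apply: (subsetP sMX); rewrite mem_mulg.
Qed.

(** The mark for arbitrary subgroups: the argument leaves the parabolic ones when it adjoins
    p-subgroups. *)
Definition fixed_cosets Y H : nat := #|'Fix_(rcosets Y [set: gT] | 'Rs)(H)|.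

(** The coset [Y x] is fixed by [H] exactly when [H] lies in [Y :^ x]. Comparing counts of such [x]
    then reduces to comparing sets of group elements. *)
Lemma fixed_cosetsE Y H :
  #|[set x | H \subset Y :^ x]| = (fixed_cosets Y H * #|Y|)%N.
Proof.
rewrite (@card_rcosets_mul Y); last first.
  by apply/subsetP=> _ /mulsgP[y x Yy + ->]; rewrite !inE conjsgM (conjGid Yy).
congr (_ * _)%N; apply: eq_card => C; apply/rcosetsP/setIP => [[x sHY ->]|[]].
  split; last by rewrite sub_afixRs_norms; rewrite inE in sHY.
  by rewrite -rcosetE; apply: imset_f; rewrite inE.
case/rcosetsP=> x _ ->; rewrite sub_afixRs_norms => sHY.
by exists x; rewrite ?inE.
Qed.

Lemma fixed_cosetsJ Y H x : fixed_cosets Y (H :^ x) = fixed_cosets Y H.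
Proof.
apply/eqP; rewrite -(eqn_pmul2r (cardG_gt0 Y)) -!fixed_cosetsE; apply/eqP.
rewrite -[RHS](card_rcoset _ x); apply: eq_card => y.
by rewrite mem_rcoset !inE conjsgM -sub_conjg.
Qed.

(** The set of [x] with [H] inside [Y :^ x] is stable under left multiplication by ['N(Y)], so
    [#|'N(Y)|] divides its size. *)
Lemma index_norm_dvd_fixed_cosets Y H : #|'N(Y) : Y| %| fixed_cosets Y H.
Proof.
rewrite -(dvdn_pmul2r (cardG_gt0 Y)) -fixed_cosetsE mulnC Lagrange ?normG //.
rewrite (@card_rcosets_mul 'N(Y)) ?dvdn_mull //.
by apply/subsetP=> _ /mulsgP[y x /normP Ny + ->]; rewrite !inE conjsgM Ny.
Qed.

Lemma fixed_cosets_self Y : fixed_cosets Y Y = #|'N(Y) : Y|.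
Proof. by rewrite /fixed_cosets afixRs_rcosets setTI. Qed.

Lemma fixed_cosets_gt0 Y H : 0 < fixed_cosets Y H -> exists x, H \subset Y :^ x.
Proof.
rewrite -(ltn_pmul2r (cardG_gt0 Y)) mul0n -fixed_cosetsE.
by case/card_gt0P=> x; rewrite inE; exists x.
Qed.

(** Normalising [H], the p-group [P] acts on the fixed points of [H]; its nontrivial orbits there
    have size divisible by p. *)
Lemma fixed_cosets_joing_pgroup (p : nat) Y H P : p.-group P -> P \subset 'N(H) ->
  fixed_cosets Y H = fixed_cosets Y (H <*> P) %[mod p].
Proof.
move=> pP nHP; rewrite /fixed_cosets (pgroup_fix_mod pP (to := 'Rs)).
  by rewrite afixYin ?subsetT // setIA.
apply: actsI; last exact: acts_fix_norm.
exact: subset_trans (subsetT _) (actsRs_rcosets _ _).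
Qed.

End FixedCosets.

(** By orbit-stabiliser the two orbit sizes differ by a ratio of indices [#|K : H|] and [#|SK : H|],
    both powers of p because [K / H] is a p-group. *)
Lemma part_orbit_joing_pgroup (aT : finGroupType) (D : {group aT})
    (T : finType) (to : action D T) (p : nat) (H P : {group aT}) (x : T) :
  P \subset D -> H \subset D -> p.-group P -> P \subset 'N(H) ->
  (#|orbit to (H <*> P) x|`_p^' = #|orbit to H x|`_p^')%N.
Proof.
move=> sPD sHD pP nHP; set K := H <*> P.
have sHK: H \subset K := joing_subl H P.
have sKD: K \subset D by rewrite join_subG sHD.
have nHK: K \subset 'N(H) by rewrite join_subG normG.
have pKH: p.-group (K / H) by rewrite /K quotientYidl // quotient_pgroup.
set SK := ('C_K[x | to])%G.
have nHS: SK \subset 'N(H) by apply: subset_trans (subsetIl _ _) nHK.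
have part1 (A : {group aT}) : A \subset K -> (#|A : H|`_p^' = 1)%N.
  move=> sAK; rewrite -card_quotient ?(subset_trans sAK) //.
  by apply: part_p'nat; rewrite pnatNK; apply: pgroupS pKH; apply: quotientS.
have eSH: SK :&: H = 'C_H[x | to].
  by rewrite /SK /= setIAC (setIidPr sHK).
have eK := card_orbit_in_stab to x sKD.
have eH := card_orbit_in_stab to x sHD.
rewrite -(Lagrange sHK) -eH -(LagrangeI SK H) eSH in eK.
have: (#|orbit to K x| * #|SK : H| = #|orbit to H x| * #|K : H|)%N.
  apply/eqP; rewrite -(eqn_pmul2r (cardG_gt0 'C_H[x | to])).
  by rewrite -mulnA [(#|SK : H| * _)%N]mulnC eK mulnAC.
move/(congr1 (fun m => m`_p^')%N); rewrite !partnM ?indexg_gt0 //; last first.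
- by rewrite (cardD1 x) orbit_refl.
- by rewrite (cardD1 x) orbit_refl.
by rewrite !part1 ?muln1 ?subsetIl.
Qed.

(** * Young subgroups as orbit-closed permutation groups *)

Section OrbitClosure.

Variable T : finType.
Implicit Types (G H Y : {group {perm T}}) (s w : {perm T}).

(** For a group [A] this is the Young subgroup of its orbit partition, the largest group with the
    same orbits. *)
Definition orbit_closure (A : {set {perm T}}) : {set {perm T}} :=
  [set s : {perm T} | [forall x, s x \in orbit 'P A x]].

Lemma orbit_closureP (A : {set {perm T}}) s :
  reflect (forall x, s x \in orbit 'P A x) (s \in orbit_closure A).
Proof. by rewrite inE; apply: forallP. Qed.

Fact orbit_closure_group_set G : group_set (orbit_closure G).
Proof.
apply/group_setP; split=> [|s t /orbit_closureP Gs /orbit_closureP Gt].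
  by apply/orbit_closureP=> x; rewrite perm1 orbit_refl.
apply/orbit_closureP=> x; rewrite permM.
exact: orbit_trans (Gt _) (Gs _).
Qed.
Canonical orbit_closure_group G := Group (orbit_closure_group_set G).

Lemma sub_orbit_closure G : G \subset orbit_closure G.
Proof. by apply/subsetP=> s Gs; apply/orbit_closureP=> x; apply: mem_orbit. Qed.

Lemma orbit_closure_sub G Y :
  orbit_closure Y = Y -> (orbit_closure G \subset Y) = (G \subset Y).
Proof.
move=> cY; apply/idP/idP; first exact: subset_trans (sub_orbit_closure G).
move=> sGY; rewrite -cY; apply/subsetP=> s /orbit_closureP Gs.
by apply/orbit_closureP=> x; apply: subsetP (imsetS _ sGY) _ (Gs x).
Qed.

Lemma orbit_closure_orbit G x : orbit 'P (orbit_closure G) x = orbit 'P G x.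
Proof.
apply/eqP; rewrite eqEsubset; apply/andP; split; last exact/imsetS/sub_orbit_closure.
by apply/subsetP=> _ /orbitP[s /orbit_closureP Gs <-]; apply: Gs.
Qed.

Lemma eq_orbit_closure (A B : {set {perm T}}) :
  orbit 'P A =1 orbit 'P B -> orbit_closure A = orbit_closure B.
Proof.
move=> eAB; apply/setP=> s; rewrite !inE.
by under eq_forallb do rewrite eAB.
Qed.

Lemma orbit_closureJ (A : {set {perm T}}) w :
  orbit_closure (A :^ w) = orbit_closure A :^ w.
Proof.
apply/setP=> s; rewrite mem_conjg; apply/orbit_closureP/orbit_closureP=> As x.
  rewrite -(orbit_conjsg _ _ w) /= !apermE.
  by have:= As (w x); rewrite !permM invgK permKV.
have := As (w^-1 x); rewrite -(orbit_conjsg _ _ w) /= !apermE.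
by rewrite !permM invgK !permKV.
Qed.

(** Every conjugate of [Y] is again closed, so it contains [H] exactly when it contains the closure
    of [H]. *)
Lemma fixed_cosets_orbit_closure Y H :
  orbit_closure Y = Y ->
  fixed_cosets Y (orbit_closure_group H) = fixed_cosets Y H.
Proof.
move=> cY; apply/eqP; rewrite -(eqn_pmul2r (cardG_gt0 Y)) -!fixed_cosetsE.
apply/eqP/eq_card => x; rewrite !inE orbit_closure_sub //=.
by rewrite orbit_closureJ cY.
Qed.

Lemma eq_orbit_fixed_cosets Y G H :
  orbit_closure Y = Y -> orbit 'P G =1 orbit 'P H ->
  fixed_cosets Y G = fixed_cosets Y H.
Proof.
move=> cY eGH; rewrite -(fixed_cosets_orbit_closure G cY).
rewrite -(fixed_cosets_orbit_closure H cY); congr fixed_cosets.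
by apply: group_inj; apply: eq_orbit_closure.
Qed.

(** The permutations that map each point to an [R]-related one form a group containing [A]. *)
Lemma orbit_gen_sub (A : {set {perm T}}) (R : rel T) :
  equivalence_rel R -> (forall s x, s \in A -> R x (s x)) ->
  forall x y, y \in orbit 'P <<A>> x -> R x y.
Proof.
move=> /equivalence_relP[Rxx Rtr] RA.
have gR: group_set [set s : {perm T} | [forall x, R x (s x)]].
  apply/group_setP; split=> [|s t]; rewrite !inE.
    by apply/forallP=> x; rewrite perm1.
  move=> /forallP Rs /forallP Rt; apply/forallP=> x; rewrite permM.
  by rewrite (Rtr _ _ (Rs x)).
move=> x _ /orbitP[s As <-]; suff: s \in Group gR by rewrite inE => /forallP.
apply: subsetP As; rewrite gen_subG; apply/subsetP=> t At; rewrite inE.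
by apply/forallP=> z; apply: RA.
Qed.

Lemma orbit_closure_tperm (A : {set {perm T}}) :
  (forall s, s \in A -> exists x y, s = tperm x y) ->
  orbit_closure <<A>> = <<A>>.
Proof.
move=> tA; apply/eqP; rewrite eqEsubset sub_orbit_closure andbT.
(* Being swapped by a transposition of the group is an equivalence relation, and it contains the
   orbit relation. *)
pose R x y := tperm x y \in <<A>>.
have Rxx x : R x x by rewrite /R tperm1.
have Rsym x y : R x y = R y x by rewrite /R tpermC.
have Rtr y x z : R x y -> R y z -> R x z.
  rewrite /R => Rxy Ryz; have [<- //|nyz] := eqVneq y z.
  have [<-|nxz] := eqVneq x z; first exact: Rxx.
  have [-> //|nxy] := eqVneq x y.
  have -> : tperm x z = tperm x y ^ tperm y z.
    by rewrite tpermJ tpermL tpermD // eq_sym.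
  by rewrite groupJ.
have Rorb x y : y \in orbit 'P <<A>> x -> R x y.
  apply: orbit_gen_sub => {x y}.
    apply/equivalence_relP; split=> // x y Rxy z; apply/idP/idP; last exact: Rtr.
    by apply: Rtr; rewrite Rsym.
  move=> s x As; have [a [b es]] := tA s As; rewrite es; case: tpermP => [->|->|] //.
    by rewrite /R -es mem_gen.
  by rewrite Rsym /R -es mem_gen.
(* Induction on the number of moved points: [s * u] below fixes [x] and every point fixed by [s]. *)
apply/subsetP=> s; have [m] := ubnP #|[set x | s x != x]|.
elim: m s => // m IHm s le_m As.
have [-> //|[x nsx]] : s = 1 \/ exists x, s x != x.
  case: (pickP (fun x => s x != x)) => [x|s1]; first by right; exists x.
  by left; apply/permP=> x; rewrite perm1; apply/eqP/negbFE/s1.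
set u := tperm x (s x); have Au: u \in <<A>> := Rorb _ _ (orbit_closureP _ _ As x).
rewrite -(groupMr s Au); apply: IHm; last first.
  exact: groupM As (subsetP (sub_orbit_closure _) _ Au).
rewrite -ltnS; apply: leq_trans le_m; rewrite ltnS; apply: proper_card.
apply/properP; split; last by exists x; rewrite !inE // permM tpermR eqxx.
apply/subsetP=> y; rewrite !inE permM; apply: contraNneq => sy.
have nxy: x != y by apply: contraNneq nsx => ->; rewrite sy.
by rewrite sy tpermD // -{1}sy (inj_eq perm_inj).
Qed.

End OrbitClosure.

(** * Conjugacy of permutations through cycle lengths *)

Section CycleSizes.

Variable T : finType.
Implicit Types s t u : {perm T}.

Lemma eq_permX s x i j :
  ((s ^+ i) x == (s ^+ j) x) = (i == j %[mod #|porbit s x|])%N.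
Proof.
set m := #|porbit s x|.
have m_gt0: (0 < m)%N by rewrite /m (cardD1 x) porbit_id.
have sMm q : (s ^+ (m * q)) x = x.
  elim: q => [|q IHq]; first by rewrite muln0 perm1.
  by rewrite mulnS expgD permM [(s ^+ m) x]permX iter_porbit.
have sX k : ((s ^+ k) x == x) = (m %| k)%N.
  rewrite {1}(divn_eq k m) mulnC expgD permM sMm /dvdn permX.
  have lt_km : (k %% m < m)%N by rewrite ltn_mod.
  rewrite -(nth_traject s lt_km) -[eqbRHS]/(iter 0 s x) -(nth_traject s m_gt0).
  by rewrite nth_uniq ?size_traject // uniq_traject_porbit.
wlog le_ij: i j / (i <= j)%N.
  by move=> IH; case/orP: (leq_total i j) => /IH // eij; rewrite eq_sym eij eq_sym.
rewrite [RHS]eq_sym eqn_mod_dvd // -sX -{1}(subnK le_ij) expgD permM.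
by rewrite (inj_eq perm_inj) eq_sym.
Qed.

Let cycles s m := [set O in porbits s | #|O| == m].

Lemma card_cycles s m :
  #|[set x | #|porbit s x| == m]| = (#|cycles s m| * m)%N.
Proof.
apply: card_uniform_partition => [O|]; first by rewrite inE => /andP[_ /eqP].
apply/and3P; split.
- apply/eqP/setP=> x; rewrite inE; apply/bigcupP/idP => [[O]|mx].
    by rewrite inE => /andP[/imsetP[y _ ->] my]; rewrite -eq_porbit_mem => /eqP ->.
  by exists (porbit s x); rewrite ?porbit_id // inE mx imset_f.
- apply/trivIsetP=> _ _ /setIdP[/imsetP[x _ ->] _] /setIdP[/imsetP[y _ ->] _].
  apply: contraNT => /pred0Pn[z /andP[/= zx zy]].
  by rewrite -eq_porbit_mem in zx; rewrite -eq_porbit_mem in zy; rewrite -(eqP zx).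
- apply/negP=> /setIdP[/imsetP[x _ x0] _].
  by have := porbit_id s x; rewrite -x0 inE.
Qed.

Lemma eq_card_porbit_conj s t :
  (forall x, #|porbit s x| = #|porbit t x|) -> exists u, t = s ^ u.
Proof.
move=> eq_st.
have m_gt0 x : (0 < #|porbit s x|)%N by rewrite (cardD1 x) porbit_id.
have eq_cycles x : #|cycles s #|porbit s x| | = #|cycles t #|porbit s x| |.
  apply/eqP; rewrite -(eqn_pmul2r (m_gt0 x)) -!card_cycles; apply/eqP/eq_card => y.
  by rewrite !inE eq_st.
(* [phi] matches the cycles of [s] with cycles of [t] of the same length; [r x]
   is a base point of the cycle of [x], [b x] one of its image under [phi], and
   the conjugating permutation sends [(s ^+ i) (r x)] to [(t ^+ i) (b x)]. *)
pose phi (O : {set T}) :=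
  nth set0 (enum (cycles t #|O|)) (index O (enum (cycles s #|O|))).
(* Equal numbers of cycles keep the index in range, so the default [set0] is never returned. *)
have lt_phi x : (index (porbit s x) (enum (cycles s #|porbit s x|))
                 < size (enum (cycles t #|porbit s x|)))%N.
  by rewrite -cardE -eq_cycles [ltnRHS]cardE index_mem mem_enum inE imset_f /=.
have phiP x : phi (porbit s x) \in cycles t #|porbit s x|.
  by rewrite -mem_enum mem_nth.
have card_phi x : #|phi (porbit s x)| = #|porbit s x|.
  by have := phiP x; rewrite inE => /andP[_ /eqP].
have phi_inj x y : phi (porbit s x) = phi (porbit s y) -> porbit s x = porbit s y.
  move=> exy; have em : #|porbit s x| = #|porbit s y| by rewrite -!card_phi exy.
  move/eqP: exy; rewrite /phi -em nth_uniq ?enum_uniq ?lt_phi //; last first.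
    by rewrite em lt_phi.
  by move/eqP; apply: (index_inj set0); rewrite mem_enum inE imset_f /= ?em.
pose r x := odflt x [pick y in porbit s x].
pose b x := odflt x [pick y in phi (porbit s x)].
have rP x : r x \in porbit s x.
  by rewrite /r; case: pickP => //= /(_ x); rewrite porbit_id.
have bP x : phi (porbit s x) = porbit t (b x).
  have /setIdP[/imsetP[y _ ey] _] := phiP x.
  rewrite /b; case: pickP => /= [z|/(_ y)]; rewrite ey ?porbit_id //.
  by rewrite -eq_porbit_mem => /eqP.
have eq_r x y : porbit s x = porbit s y -> r x = r y.
  by move=> exy; rewrite /r exy; case: pickP => //= /(_ y); rewrite porbit_id.
have eq_b x y : porbit s x = porbit s y -> b x = b y.
  by move=> exy; rewrite /b exy; case: pickP => //= /(_ (b y)); rewrite bP porbit_id.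
pose i x := index x (traject s (r x) #|porbit s (r x)|).
have iP x : (s ^+ i x) (r x) = x.
  have xr : x \in traject s (r x) #|porbit s (r x)|.
    by rewrite -porbit_traject porbit_sym.
  have lt_i : (i x < #|porbit s (r x)|)%N.
    by rewrite -[ltnRHS](size_traject s (r x)) index_mem.
  by rewrite permX -(nth_traject s lt_i) nth_index.
pose u x := (t ^+ i x) (b x).
have card_b x : #|porbit t (b x)| = #|porbit s (r x)|.
  by rewrite -bP card_phi; move: (rP x); rewrite -eq_porbit_mem => /eqP ->.
have eq_porbit_s x : porbit s (s x) = porbit s x.
  by rewrite -{2}[s]expg1 porbit_perm.
have us x : u (s x) = t (u x).
  (* At the end of a cycle [i] wraps around to 0, so [i (s x)] and [(i x).+1] agree only modulo the
     common cycle length. *)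
  rewrite /u (eq_b _ _ (eq_porbit_s x)) -permM -expgSr; apply/eqP.
  rewrite eq_permX card_b -eq_permX -{1}(eq_r _ _ (eq_porbit_s x)) iP.
  by rewrite expgSr permM iP.
have u_inj : injective u.
  move=> x y eq_u.
  have exy : porbit s x = porbit s y.
    apply: phi_inj; rewrite !bP; apply/eqP.
    rewrite -(porbit_perm t (i x) (b x)) -/(u x) eq_u.
    by rewrite porbit_perm.
  move/eqP: eq_u; rewrite /u (eq_b _ _ exy) eq_permX card_b -eq_permX.
  by rewrite iP -(eq_r _ _ exy) iP => /eqP.
exists (perm u_inj); apply/permP=> x.
by rewrite -{1}[x](permKV (perm u_inj)) conjgE !permM permE -us permE.
Qed.

End CycleSizes.

(** A transposition joining two distinct cycles merges them: from [x] the product runs through the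
    [s]-cycle of [y], then passes from [y] to [s x]. *)
Lemma porbit_tperm_mul (T : finType) (s : {perm T}) x y :
  y \notin porbit s x ->
  porbit (tperm x y * s) y = porbit (tperm x y * s) x
  /\ forall z, porbit (tperm x y * s) (s z) = porbit (tperm x y * s) z.
Proof.
move=> nxy; set c := tperm x y * s.
have cE z : porbit c (c z) = porbit c z by rewrite -{2}[c]expg1 porbit_perm.
have cx : c x = s y by rewrite permM tpermL.
have cy : c y = s x by rewrite permM tpermR.
have cD z : x != z -> y != z -> c z = s z by move=> *; rewrite permM tpermD.
have sXy k : porbit c ((s ^+ k.+1) y) = porbit c x.
  elim: k => [|k IHk]; first by rewrite expg1 -cx cE.
  rewrite expgSr permM; have [<-|ny] := eqVneq y ((s ^+ k.+1) y).
    by rewrite -cx cE.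
  rewrite -cD ?cE //; apply: contraNneq nxy => ->.
  by rewrite porbit_sym mem_porbit.
have eyx : porbit c y = porbit c x.
  rewrite -(sXy #|porbit s y|.-1) prednK; last by rewrite (cardD1 y) porbit_id.
  by rewrite permX iter_porbit.
split=> // z; have [<-|nx] := eqVneq x z; first by rewrite -cy cE.
by have [<-|ny] := eqVneq y z; rewrite ?eyx -?cx -?cD ?cE.
Qed.

(** * Coxeter elements and parabolic subgroups of the symmetric group *)

Section SymmetricGroup.

Variable n : nat.
Implicit Types (J : {set 'S_n}) (G : {group 'S_n}).

Lemma simple_transpositionsP (s : 'S_n) :
  reflect (exists i j : 'I_n, j = i.+1 :> nat /\ s = tperm i j)
          (s \in simple_transpositions n).
Proof.
rewrite inE; apply: (iffP existsP) => [[i /existsP[j /andP[/eqP ji /eqP es]]]|].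
  by exists i, j.
by case=> i [j [ji es]]; exists i; apply/existsP; exists j; rewrite ji es !eqxx.
Qed.

Lemma orbit_closure_simple J :
  J \subset simple_transpositions n -> orbit_closure <<J>> = <<J>>.
Proof.
move=> sJS; apply: orbit_closure_tperm => s /(subsetP sJS).
by case/simple_transpositionsP=> i [j [_ ->]]; exists i, j.
Qed.

(** By induction each new first factor merges two cycles of the remaining product, so no factor
    moves a point out of its cycle, whatever the order. *)
Lemma orbit_prod_simple (r : seq 'S_n) :
    uniq r -> {subset r <= simple_transpositions n} ->
  forall t z, t \in r ->
    porbit (\prod_(s <- r) s) (t z) = porbit (\prod_(s <- r) s) z.
Proof.
elim: r => // a r IHr /= /andP[nar Ur] Sr; rewrite big_cons.
have {}IHr := IHr Ur (fun x rx => Sr x (mem_behead (s := a :: r) rx)).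
set c := \prod_(s <- r) s in IHr *.
have /simple_transpositionsP[i [j [ji ea]]] := Sr a (mem_head a r).
(* Only [a] crosses the cut between [i] and [j], and it does not recur in [r]; hence [c] preserves
   the points up to [i]. *)
have /porbit_tperm_mul[] : j \notin porbit c i.
  have rc: c \in <<[set s in r]>>.
    by rewrite /c big_seq; apply: group_prod => s rs; apply: mem_gen; rewrite inE.
  apply/negP=> cij; suff: (i <= i)%N == (j <= i)%N by rewrite leqnn ji ltnn.
  pose R (x y : 'I_n) := (x <= i)%N == (y <= i)%N.
  apply: (@orbit_gen_sub _ [set s in r] R).
  - by move=> x y z; rewrite /R; split=> // /eqP ->.
  - move=> s x; rewrite inE => rs.
    have /simple_transpositionsP[k [l [lk es]]] : s \in simple_transpositions n.
      by apply: Sr; rewrite inE rs orbT.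
    suff kl: (k <= i)%N = (l <= i)%N.
      by rewrite /R es; case: tpermP => [->|->|]; rewrite ?kl.
    have nki: k != i.
      apply: contraNneq nar => eki; rewrite ea -eki.
      suff <- : l = j by rewrite -es.
      by apply: val_inj; rewrite /= lk ji eki.
    by rewrite lk leq_eqVlt (inj_eq val_inj) (negPf nki).
  - move: cij; rewrite porbitE; apply: subsetP; apply: imsetS.
    by rewrite cycle_subG.
rewrite -ea => eji ec t z; rewrite inE => /predU1P[->|rt].
  by rewrite {2}ea; case: tpermP => [->|->|].
apply/eqP; rewrite eq_porbit_mem.
have: t z \in porbit c z by rewrite -eq_porbit_mem IHr.
case/porbitP=> m ->; elim: m => [|m IHm]; first by rewrite perm1 porbit_id.
by rewrite expgSr permM -eq_porbit_mem ec eq_porbit_mem.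
Qed.

Lemma orbit_coxeter_element J c :
    J \subset simple_transpositions n -> coxeter_element J c ->
  orbit 'P <<J>> =1 porbit c.
Proof.
move=> sJS [r pr ec] x; have mr t : (t \in r) = (t \in J).
  by rewrite (perm_mem pr) mem_enum.
apply/eqP; rewrite eqEsubset; apply/andP; split; apply/subsetP=> y.
  move/orbit_gen_sub => /(_ (fun x y => porbit c x == porbit c y)) xy.
  rewrite -eq_porbit_mem eq_sym; apply: xy => [u v w|s z Js].
    by split=> // /eqP ->.
  rewrite eq_sym ec orbit_prod_simple ?mr // ?(perm_uniq pr) ?enum_uniq //.
  by move=> t; rewrite mr; apply: subsetP.
rewrite porbitE; apply: subsetP; apply: imsetS; rewrite cycle_subG ec.
by rewrite big_seq; apply: group_prod => s; rewrite mr; apply: mem_gen.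
Qed.

Lemma orbit_closure_conj_simple G :
  exists2 J : {set 'S_n}, J \subset simple_transpositions n &
    exists w : 'S_n, <<J>> = orbit_closure G :^ w.
Proof.
(* Sorting the points by orbit makes the orbits intervals. *)
pose lab (x : 'I_n) : nat := enum_rank (orbit 'P G x).
have labP x y : (lab x == lab y) = (y \in orbit 'P G x).
  rewrite (inj_eq val_inj) (inj_eq enum_rank_inj) eq_sym.
  by apply/eqP/idP=> /orbit_eqP.
(* The sorting permutation [w] makes the labels [f] nondecreasing. *)
have /tuple_permP[w ew] :
  perm_eq (sort (relpre lab leq) (ord_tuple n)) (ord_tuple n) by rewrite perm_sort.
pose f (i : 'I_n) := lab (w i).
have f_mono (i j : 'I_n) : (i <= j)%N -> (f i <= f j)%N.
  have sf: sorted leq [seq f k | k <- enum 'I_n].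
    have -> : [seq f k | k <- enum 'I_n] =
              map lab (sort (relpre lab leq) (ord_tuple n)).
      by rewrite ew /= -map_comp; apply: eq_map => k; rewrite /= tnth_ord_tuple.
    by rewrite -sort_map; apply: sort_sorted leq_total _.
  have ltf (k : 'I_n) : (val k < size [seq f i | i <- enum 'I_n])%N.
    by rewrite size_map size_enum_ord ltn_ord.
  have nf (k : 'I_n) : nth 0%N [seq f i | i <- enum 'I_n] k = f k.
    by rewrite (nth_map k) ?nth_ord_enum // size_enum_ord ltn_ord.
  by move/(sorted_leq_nth leq_trans leqnn 0%N sf _ _ (ltf i) (ltf j)); rewrite !nf.
(* The adjacent transpositions inside the intervals on which [f] is constant. *)
pose J := [set s : 'S_n | [exists i : 'I_n, exists j : 'I_n,
  [&& j == i.+1 :> nat, f i == f j & s == tperm i j]]].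
have sJS: J \subset simple_transpositions n.
  apply/subsetP=> s; rewrite inE => /existsP[i /existsP[j /and3P[/eqP ji _]]].
  move/eqP=> es.
  by apply/simple_transpositionsP; exists i, j.
exists J => //; exists w^-1.
rewrite -orbit_closure_simple // -orbit_closureJ; apply: eq_orbit_closure => x.
apply/setP=> y.
have -> : (y \in orbit 'P (G :^ w^-1) x) = (f x == f y).
  by rewrite labP -(orbit_conjsg _ _ w^-1 (w x)) /= !apermE !permK.
apply/idP/eqP => [xy|].
  apply/eqP; move: x y xy; apply: orbit_gen_sub => [u v z|s z].
    by split=> // /eqP ->.
  rewrite inE => /existsP[i /existsP[j /and3P[_ /eqP ij /eqP ->]]].
  by case: tpermP => [->|->|]; rewrite ?ij.
wlog le_xy: x y / (x <= y)%N.
  move=> IH; case/orP: (leq_total x y) => [|le_yx exy]; first exact: IH.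
  by rewrite orbit_sym IH.
(* Walk from [x] to [y] through neighbours; monotonicity keeps [f] constant on the way. *)
move: le_xy; have [d] := ubnP (y - x)%N; elim: d x => // d IHd x le_d.
rewrite leq_eqVlt => /predU1P[/val_inj -> _|lt_xy exy]; first exact: orbit_refl.
pose z := Ordinal (leq_ltn_trans lt_xy (ltn_ord y)).
have exz: f x = f z.
  by apply/eqP; rewrite eqn_leq f_mono ?leqnSn // exy f_mono.
have zy: y \in orbit 'P <<J>> z.
  apply: IHd => //; last by rewrite -exz.
  by rewrite -ltnS; apply: leq_trans le_d; rewrite ltnS /= ltn_sub2l.
apply: orbit_trans zy _; rewrite -[z](tpermL x z) -[tperm x z x]apermE mem_orbit //.
apply: mem_gen; rewrite inE; apply/existsP; exists x; apply/existsP; exists z.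
by rewrite exz !eqxx.
Qed.

End SymmetricGroup.

Lemma conj_representatives_ex (gT : finGroupType) (S J : {set gT}) E :
    conj_representatives S E -> J \subset S ->
  exists2 J0, J0 \in E & exists x, J0 = J :^ x.
Proof.
case/and3P=> _ _ /forall_inP oneE sJS.
pose B := [set K in powerset S | K \in J :^: [set: gT]].
have /oneE/cards1P[J0 EJ0] :
    B \in equivalence_partition (fun J K => K \in J :^: [set: gT]) (powerset S).
  by apply: imset_f; rewrite inE.
have /setIP[EJ] : J0 \in E :&: B by rewrite EJ0 set11.
by case/setIdP=> _ /imsetP[x _ eJ]; exists J0 => //; exists x.
Qed.

(** * Cyclic groups and p-regular parts *)

Section PRegularPart.

Variables (gT : finGroupType) (p : nat) (c : gT).

Lemma cycle_constt_pgroup : p.-group <[c.`_p]>.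
Proof. exact: p_elt_constt. Qed.

Lemma cycle_constt_norm : <[c.`_p]> \subset 'N(<[c.`_p^']>).
Proof.
by rewrite cents_norm // cent_cycle cycle_subG; apply/cent1P; apply: commuteX2.
Qed.

Lemma cycle_consttY : <[c]> = <[c.`_p^']> <*> <[c.`_p]>.
Proof.
apply/eqP; rewrite eqEsubset join_subG !cycle_subG !cycle_constt !andbT.
rewrite -{1}(consttC p c) groupM // -cycle_subG.
  exact: joing_subr.
exact: joing_subl.
Qed.

Lemma fixed_cosets_constt (Y : {group gT}) :
  fixed_cosets Y <[c]> = fixed_cosets Y <[c.`_p^']> %[mod p].
Proof.
rewrite (fixed_cosets_joing_pgroup Y cycle_constt_pgroup cycle_constt_norm).
by congr (fixed_cosets _ _ %% _)%N; apply: group_inj; apply: cycle_consttY.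
Qed.

End PRegularPart.

(** Adjoining the p-part of [s] preserves the p'-part of orbit sizes, and orbits of the p-regular
    part already have size prime to p. *)
Lemma card_porbit_constt (T : finType) (p : nat) (s : {perm T}) x :
  (#|porbit s.`_p^' x| = #|porbit s x|`_p^')%N.
Proof.
rewrite !porbitE (cycle_consttY p s).
rewrite (part_orbit_joing_pgroup _ x (subsetT _) (subsetT _)
           (cycle_constt_pgroup p s) (cycle_constt_norm p s)).
rewrite part_pnat_id //; apply: pnat_dvd (dvdn_orbit _ _ _) _.
exact: p_elt_constt.
Qed.

(** * Columns of the table of marks modulo p *)

Section MarksModulo.

Variables (n p : nat) (E : {set {set 'S_n}}).
Hypotheses (p_prime : prime p)
           (E_repr : conj_representatives (simple_transpositions n) E).
Implicit Types (J K L : {set 'S_n}) (G : {group 'S_n}).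

Lemma conj_representatives_simple J : J \in E -> J \subset simple_transpositions n.
Proof. by case/and3P: E_repr => _ /subsetP sE _ /sE; rewrite powersetE. Qed.

Lemma orbit_closure_conj_repr G :
  exists2 J, J \in E & exists w : 'S_n, <<J>> = orbit_closure G :^ w.
Proof.
have [J sJS [w eJ]] := orbit_closure_conj_simple G.
have [J0 EJ0 [x eJ0]] := conj_representatives_ex E_repr sJS.
by exists J0 => //; exists (w * x); rewrite eJ0 genJ eJ conjsgM.
Qed.

(** The diagonal entry is the index of [<<L>>] in its normaliser and divides the whole row. *)
Lemma nonzero_row_mark L : L \in nonzero_rows E p -> ~~ (p %| mark L L)%N.
Proof.
case/setIdP=> _ /exists_inP[K _ nz]; apply: contra nz => pL.
have := index_norm_dvd_fixed_cosets <<L>>%G <<K>>%G.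
rewrite -fixed_cosets_self => /(dvdn_trans pL) pK.
by rewrite eqn_mod_dvd ?subn0.
Qed.

Lemma decomposition_entryP K L :
  reflect (forall J, J \in E -> mark J K = mark J L %[mod p])
          (decomposition_entry E p K L == 1%N).
Proof.
rewrite /decomposition_entry; case: forall_inP => H; constructor.
  by move=> J /H /eqP.
by move=> H'; apply: H => J /H' ->.
Qed.

Lemma decomposition_entry_constt K L cK cL :
    K \in E -> L \in E -> coxeter_element K cK -> coxeter_element L cL ->
    cK.`_p^' \in cL.`_p^' ^: [set: 'S_n] ->
  decomposition_entry E p K L = 1%N.
Proof.
move=> /conj_representatives_simple sK /conj_representatives_simple sL.
move=> coxK coxL /imsetP[w _ eKL].
apply/eqP/decomposition_entryP=> J.
move=> /conj_representatives_simple/orbit_closure_simple clJ.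
have mark_constt (M : {set 'S_n}) (c : 'S_n) : M \subset simple_transpositions n ->
    coxeter_element M c ->
  mark J M = fixed_cosets <<J>>%G <[c.`_p^']> %[mod p].
  move=> sM coxM; rewrite -fixed_cosets_constt; congr (_ %% _)%N.
  apply: (@eq_orbit_fixed_cosets _ <<J>>%G <<M>>%G) => // x.
  by rewrite (orbit_coxeter_element sM coxM) porbitE.
rewrite (mark_constt _ _ sK coxK) (mark_constt _ _ sL coxL) eKL.
rewrite -(fixed_cosetsJ _ <[cL.`_p^']> w); congr (fixed_cosets _ _ %% _)%N.
by apply: group_inj; rewrite /= cycleJ.
Qed.

Lemma conj_orbit_sizes K L :
    K \in E -> L \in nonzero_rows E p -> decomposition_entry E p K L = 1%N ->
  exists w : 'S_n, forall x,
    (#|orbit 'P <<K>> x|`_p^' = #|orbit 'P <<L>> (w x)|`_p^')%N.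
Proof.
move=> EK FL /eqP/decomposition_entryP eKL.
have EL : L \in E by case/setIdP: FL.
(* The two invariants of the process; a [good] group of maximal order replaces the iteration. *)
pose good G := [forall J in E, fixed_cosets <<J>>%G G == mark J L %[mod p]]%N
   && [forall x, #|orbit 'P <<K>> x|`_p^' == #|orbit 'P G x|`_p^']%N.
have goodK : good <<K>>%G.
  apply/andP; split; last by apply/forallP.
  by apply/forall_inP=> J EJ; apply/eqP/eKL.
case: (arg_maxnP (fun G : {group 'S_n} => #|G|) goodK) => G.
case/andP=> /forall_inP markG /forallP orbG maxG.
have clG : orbit_closure G = G.
  apply/eqP; rewrite eq_sym eqEcard sub_orbit_closure.
  apply: (maxG (orbit_closure_group G)); apply/andP; split.
    apply/forall_inP=> J EJ; rewrite fixed_cosets_orbit_closure ?markG //.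
    exact/orbit_closure_simple/conj_representatives_simple.
  by apply/forallP=> x; rewrite orbit_closure_orbit.
have [J EJ [w eJ]] := orbit_closure_conj_repr G; rewrite clG in eJ.
(* A Sylow p-subgroup of ['N(G)] can be adjoined to [G], so maximality puts it inside [G]. *)
have p'G : ~~ (p %| #|'N(G) : G|)%N.
  have [P sylP] := Sylow_exists p 'N(G).
  have [sPN pP p'P] := and3P sylP.
  suff sPG : P \subset G.
    rewrite -p'natE //; apply: pnat_dvd p'P.
    exact: indexgS.
  have: G <*> P \subset G; last exact: subset_trans (joing_subr _ _).
  rewrite -(geq_leqif (subset_leqif_card (joing_subl G P))).
  apply: (maxG (G <*> P)%G); apply/andP; split.
    apply/forall_inP=> J' EJ'.
    by rewrite -(fixed_cosets_joing_pgroup _ pP sPN) markG.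
  apply/forallP=> x.
  by rewrite (part_orbit_joing_pgroup _ x (subsetT _) (subsetT _) pP sPN).
have gt0_mod m m' : ~~ (p %| m)%N -> m = m' %[mod p] -> (0 < m')%N.
  by case: m' => // /negP npm; rewrite mod0n => /eqP/npm.
(* The entry of row [J] at [G] is [#|'N(G) : G|], nonzero modulo p, so [mark J L] is positive. *)
have [y sLJ] : exists y, <<L>> \subset <<J>>%G :^ y.
  apply: fixed_cosets_gt0; apply: gt0_mod (eqP (markG J EJ)).
  rewrite -(fixed_cosetsJ _ G w); have -> : (G :^ w)%G = <<J>>%G by apply: group_inj.
  by rewrite fixed_cosets_self /= eJ normJ indexJg.
(* Here the diagonal entry of [L] is nonzero modulo p, so some coset of [<<L>>] is fixed by [G]. *)
have [z sGL] : exists z, G \subset <<L>>%G :^ z.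
  apply: fixed_cosets_gt0; apply: gt0_mod (nonzero_row_mark FL) _.
  by rewrite -(eqP (markG L EL)).
have eGL : G :=: <<L>> :^ z.
  apply/eqP; rewrite eqEcard sGL cardJg.
  by rewrite -(cardJg G w) -(cardJg (G :^ w) y) -eJ subset_leq_card.
exists z^-1 => x; rewrite (eqP (orbG x)).
rewrite eGL -[x in orbit _ _ x](permKV z) -(setact_orbit 'P%act <<L>> _ z).
by rewrite card_setact.
Qed.

End MarksModulo.

Theorem theorem6 (n p : nat) (E : {set {set 'S_n}}) (K L : {set 'S_n})
    (cK cL : 'S_n) (n_gt0 : (0 < n)%N) (p_prime : prime p)
    (E_repr : conj_representatives (simple_transpositions n) E)
    (K_in : K \in E) (L_in : L \in nonzero_rows E p)
    (cK_cox : coxeter_element K cK) (cL_cox : coxeter_element L cL) :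
  decomposition_entry E p K L = 1%N <->
  (cK.`_p^' \in cL.`_p^' ^: [set: 'S_n])%g.
Proof.
have L_E : L \in E by case/setIdP: L_in.
split=> [eKL|cKL]; last first.
  exact: (decomposition_entry_constt E_repr K_in L_E cK_cox cL_cox cKL).
have [w orbKL] := conj_orbit_sizes p_prime E_repr K_in L_in eKL.
(* Conjugating by [w^-1] first absorbs the relabelling, so that cycle lengths agree at each
   point. *)
have [u eu] : exists u, cK.`_p^' = (cL.`_p^' ^ w^-1) ^ u.
  apply: eq_card_porbit_conj => x.
  have -> : #|porbit (cL.`_p^' ^ w^-1) x| = #|porbit cL.`_p^' (w x)|.
    rewrite !porbitE cycleJ -[x in LHS](permK w).
    by rewrite -(setact_orbit 'P%act _ (w x) w^-1) card_setact.
  have sK := conj_representatives_simple E_repr K_in.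
  have sL := conj_representatives_simple E_repr L_E.
  rewrite !card_porbit_constt -(orbit_coxeter_element sK cK_cox).
  by rewrite -(orbit_coxeter_element sL cL_cox) orbKL.
by apply/imsetP; exists (w^-1 * u); rewrite ?inE // conjgM.
Qed.
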